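(* Let $K$ be an algebraically closed field of characteristic zero and let $A$ be a generalized block-triangular algebra over $K$. Then the sum of two commutators of $A$ is again a commutator of $A$; that is, for all $x_1, y_1, x_2, y_2 \in A$ there exist $x, y \in A$ with $[x_1,y_1] + [x_2,y_2] = [x,y]$, where $[u,v] = uv - vu$.
   Context: Algebras are associative and unital. Let $K$ be an algebraically closed field of characteristic zero and let $A$ be a finite-dimensional unital associative $K$-algebra with Jacobson radical $\operatorname{rad}(A)$. By the Wedderburn-Malcev theorem there is a semisimple subalgebra $B$ of $A$ with $A = B \oplus \operatorname{rad}(A)$ (direct sum of vector spaces), and there is an algebra isomorphism $B \simeq M_{d_1}(K) \oplus \cdots \oplus M_{d_r}(K)$ with $d_1,\dots,d_r \geq 1$. One has $1_A = 1_B$. Let $e_i \in B$ be the element corresponding to the identity matrix of $M_{d_i}(K)$, so that $1_A = e_1 + \cdots + e_r$ with the $e_i$ orthogonal idempotents, and set $\operatorname{rad}(A)_{ij} = e_i \operatorname{rad}(A) e_j$. The algebra $A$ is called a generalized block-triangular algebra if, for some such decomposition and some numbering of the simple components of $B$, $\operatorname{rad}(A)_{ij} = 0$ for all $i \geq j$. *)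

(* Defs.v *)
From mathcomp Require Import all_boot all_order all_algebra all_field.

Set Implicit Arguments.
Unset Strict Implicit.
Unset Printing Implicit Defensive.

Import GRing.Theory.
Local Open Scope ring_scope.

Definition ring_commutator (R : pzRingType) (u v : R) : R := u * v - v * u.

Section BlockTriangular.

Variables (K : fieldType) (A : falgType K).

(* A left ideal of a unital algebra is stable under scaling, since            *)
(* c *: x = (c *: 1) * x, so every left ideal is a subspace.                  *)
Definition left_ideal (I : {vspace A}) : Prop := (fullv * I <= I)%VS.

Definition maximal_left_ideal (M : {vspace A}) : Prop :=
  [/\ left_ideal M, M != fullv
    & forall I : {vspace A},
        left_ideal I -> (M <= I)%VS -> I != fullv -> I = M].

Definition jacobson_radical (x : A) : Prop :=
  forall M : {vspace A}, maximal_left_ideal M -> x \in M.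

Definition is_jacobson_radical (J : {vspace A}) : Prop :=
  forall x : A, x \in J <-> jacobson_radical x.

(* An algebra morphism from B to a finite product of matrix algebras is a     *)
(* family of algebra morphisms to its factors; it is an isomorphism exactly   *)
(* when it is bijective. The size d i + 1 makes every factor nonzero.         *)
Definition product_isomorphism (B : {aspace A}) (r : nat) (d : 'I_r -> nat)
    (phi : forall i, {lrmorphism subvs_of B -> 'M[K]_((d i).+1)}) : Prop :=
  bijective
    (fun b => [ffun i => phi i b] : {dffun forall i, 'M[K]_((d i).+1)}).

(* B is semisimple by virtue of the isomorphism phi; the numbering of its     *)
(* simple components is the order of 'I_r. The element e i is the one whose   *)
(* image in the product is the identity in the factor i and 0 in the others.  *)
Definition generalized_block_triangular : Prop :=
  exists (J : {vspace A}) (B : {aspace A}) (r : nat) (d : 'I_r -> nat)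
         (phi : forall i, {lrmorphism subvs_of B -> 'M[K]_((d i).+1)})
         (e : 'I_r -> subvs_of B),
  [/\ is_jacobson_radical J,
      [/\ 1 \in B, (B + J = fullv)%VS & (B :&: J = 0)%VS],
      product_isomorphism phi,
      forall i k : 'I_r, phi k (e i) = (k == i)%:R
    & forall i j : 'I_r, (j <= i)%N ->
        {in J, forall x, vsval (e i) * x * vsval (e j) = 0}].

End BlockTriangular.

(* Main.v *)
(** A sum of commutators is [b + n] with [n] in the radical [J] and [b] in the
    semisimple part, every block of [b] having trace zero.  In characteristic
    zero such a block is similar to a matrix with zero diagonal, hence is
    [[D_i, Y_i]] for a diagonalizable [D_i] whose distinct eigenvalues can be
    prescribed.  Choose the eigenvalues distinct across all blocks: as
    [e_i J e_i = 0], the derivation [ad D] is injective, hence bijective, on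
    [J], so [n = [D, m]] and [b + n = [D, Y + m]]. *)

Require Import Defs.
From mathcomp Require Import all_boot all_order all_algebra all_field.

Set Implicit Arguments.
Unset Strict Implicit.
Unset Printing Implicit Defensive.

Import GRing.Theory.
Local Open Scope ring_scope.

(** * The Jacobson radical as a two-sided ideal *)

Section Radical.
Variables (K : fieldType) (A : falgType K).
Implicit Types (J M : {vspace A}).

(** The preimage is the annihilator of the class of [a] in the simple module [A/M]. That class is
    nonzero, hence generates [A/M], so the quotient of [A] by the preimage is again simple. This
    gives stability of the radical under right multiplication. *)
Lemma maximal_left_ideal_colon M a : maximal_left_ideal M ->
  a \notin M -> maximal_left_ideal (amulr a @^-1: M)%VS.
Proof.
move=> [idM _ maxM] aM.
have colonE x : (x \in (amulr a @^-1: M)%VS) = (x * a \in M).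
  by rewrite -memv_preim lfunE.
have colon1 : 1 \notin (amulr a @^-1: M)%VS by rewrite colonE mul1r.
split.
- apply/prodvP => u v _; rewrite !colonE -mulrA => va.
  by apply: (subvP idM); rewrite memv_mul ?memvf.
- by apply: contraNneq colon1 => ->; rewrite memvf.
move=> I idI sMI /eqP nI; apply/eqP; rewrite eqEsubv sMI andbT.
have idIM : left_ideal (amulr a @: I + M)%VS.
  apply/prodvP => u v _ /memv_addP[_ /memv_imgP[i iI ->] [m mM ->]].
  rewrite lfunE /= mulrDr; apply: memv_add.
    apply/memv_imgP; exists (u * i); last by rewrite lfunE /= mulrA.
    by apply: (subvP idI); rewrite memv_mul ?memvf.
  by apply: (subvP idM); rewrite memv_mul ?memvf.
(* Maximality of [M] leaves two cases for [I a + M]. If it is everything, each [c * a] is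
   [i * a + m], so [c - i] lies in the colon ideal, which is contained in [I], and [I] is full. If
   it is [M], then [I a] lies in [M]. *)
have [IMT | nIM] := eqVneq (amulr a @: I + M)%VS fullv.
  case: nI; apply/eqP; rewrite eqEsubv subvf; apply/subvP => c _.
  have: c * a \in (amulr a @: I + M)%VS by rewrite IMT memvf.
  move=> /memv_addP[_ /memv_imgP[i iI ->] [m mM]]; rewrite lfunE /= => ca.
  rewrite -[c](subrK i) memvD //; apply: (subvP sMI).
  by rewrite colonE mulrBl ca addrAC subrr add0r.
rewrite -(maxM _ idIM (addvSr _ _) nIM); apply/subvP => i iI.
rewrite -memv_preim; apply: (subvP (addvSl _ _)).
by apply: memv_img.
Qed.

Lemma jacobson_radicalMl J a x :
  is_jacobson_radical J -> x \in J -> a * x \in J.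
Proof.
move=> radJ /radJ Jx; apply/radJ => M maxM; have [idM _ _] := maxM.
by apply: (subvP idM); rewrite memv_mul ?memvf ?Jx.
Qed.

Lemma jacobson_radicalMr J a x :
  is_jacobson_radical J -> x \in J -> x * a \in J.
Proof.
move=> radJ /radJ Jx; apply/radJ => M maxM.
have [aM | aM] := boolP (a \in M).
  by have [idM _ _] := maxM; apply: (subvP idM); rewrite memv_mul ?memvf.
have /Jx := maximal_left_ideal_colon maxM aM.
by rewrite -memv_preim lfunE.
Qed.

End Radical.

(** * Inverting the derivation [ad D] on an ideal *)

(* The [E t] are the spectral idempotents of [D], with eigenvalues [s t]. *)
Lemma ad_surjective (K : fieldType) (A : falgType K) (J : {vspace A}) (D : A)
    (T : finType) (E : T -> A) (s : T -> K) :
    \sum_t E t = 1 -> injective s ->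
    (forall t, D * E t = s t *: E t) -> (forall t, E t * D = s t *: E t) ->
    (forall t, {in J, forall m, E t * m * E t = 0}) ->
    {in J, forall m, D * m \in J} -> {in J, forall m, m * D \in J} ->
  {in J, forall n, exists m, n = ring_commutator D m}.
Proof.
move=> sumE injs DE ED EJE DJ JD n nJ.
pose f := (amull D - amulr D)%R.
have fE m : f m = D * m - m * D by rewrite !lfun_simp /=.
have kerf : (J :&: lker f = 0)%VS.
  apply/eqP; rewrite -subv0; apply/subvP => m.
  rewrite memv_cap memv_ker fE subr_eq0 memv0 => /andP[mJ /eqP Dm].
  (* Decompose [m] into the pieces [E t * m * E u]. The diagonal ones vanish by [EJE]; on the others
     [ad D] acts as the nonzero scalar [s t - s u]. *)
  rewrite -[m]mulr1 -[m]mul1r -sumE !mulr_suml big1 // => t _.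
  rewrite mulr_sumr big1 // => u _.
  have [<-|ntu] := eqVneq t u; first exact: EJE.
  have: (s t - s u) *: (E t * m * E u) = 0.
    rewrite scalerBl !scalerAl -ED -!scalerAl scalerAr -DE.
    by rewrite -!mulrA (mulrA D) Dm !mulrA subrr.
  by move/eqP; rewrite scaler_eq0 subr_eq0 (inj_eq injs) (negPf ntu) => /eqP.
have sfJ : (f @: J <= J)%VS.
  by apply/subvP => _ /memv_imgP[m mJ ->]; rewrite fE memvB ?DJ ?JD.
have: n \in (f @: J)%VS.
  suff -> : (f @: J = J)%VS by [].
  by apply/eqP; rewrite eqEdim sfJ (limg_dim_eq kerf) /=.
by case/memv_imgP => m _ ->; exists m; rewrite fE.
Qed.

Lemma natr_inj_pchar0 (K : fieldType) : [pchar K] =i pred0 ->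
  injective (fun n : nat => n%:R : K).
Proof.
move=> charK0.
have le m n : (m <= n)%N -> m%:R = n%:R :> K -> m = n.
  move=> lemn /esym/eqP; rewrite -subr_eq0 -natrB //.
  rewrite (pcharf0P K).1 // subn_eq0 => lenm; apply/eqP.
  by rewrite eqn_leq lemn.
move=> m n /= eqmn; have [/le->//|/ltnW/le->//] := leqP m n.
Qed.

(** * Trace-zero matrices as commutators with a prescribed spectrum *)

Section TraceZero.
Variable K : fieldType.
Hypothesis charK0 : [pchar K] =i pred0.

Lemma invmx_eq n (P Q : 'M[K]_n) : P *m Q = 1%:M -> invmx P = Q.
Proof.
move=> PQ; have [uP _] := mulmx1_unit PQ.
by rewrite -[Q](mulKmx uP) PQ mulmx1.
Qed.

Lemma mulmx_block_upperK n (u : 'rV[K]_n) :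
  block_mx 1%:M u 0 1%:M *m block_mx 1%:M (- u) 0 1%:M = 1%:M.
Proof.
rewrite mulmx_block !(mul1mx, mulmx1, mul0mx, mulmx0, addr0, add0r) addNr.
by rewrite -scalar_mx_block.
Qed.

Lemma mulmx_block_lowerK n (u : 'cV[K]_n) :
  block_mx 1%:M 0 u 1%:M *m block_mx 1%:M 0 (- u) 1%:M = 1%:M.
Proof.
rewrite mulmx_block !(mul1mx, mulmx1, mul0mx, mulmx0, addr0, add0r) subrr.
by rewrite -scalar_mx_block.
Qed.

(** When [r = 0], the shear [u = x *: delta_mx 0 j] produces the entry [x (N_jj - a) - x^2 c_j].
    Vanishing at both [x = 1] and [x = -1] would give [2 (N_jj - a) = 0], impossible in
    characteristic zero. *)
Lemma conj_ursubmx_neq0 n (M : 'M[K]_(1 + n)) (j : 'I_n) :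
    M (rshift 1 j) (rshift 1 j) != M (lshift n 0) (lshift n 0) ->
  exists2 P, P \in unitmx & ursubmx (P *m M *m invmx P) != 0.
Proof.
rewrite -[M]submxK block_mxEdr block_mxEul.
set a := ulsubmx M; set r := ursubmx M; set c := dlsubmx M; set N := drsubmx M.
move=> neqNa.
have [r0|nr0] := eqVneq r 0; last first.
  by exists 1%:M; rewrite ?unitmx1 // invmx1 mul1mx mulmx1 block_mxKur.
(* [v u] is the upper right block of the conjugate of [M] by the shear [u]. *)
pose v (u : 'rV[K]_n) := - ((a + u *m c) *m u) + u *m N.
suff [u nzv] : exists u, v u != 0.
  have uQ := mulmx_block_upperK u; have [uP _] := mulmx1_unit uQ.
  exists (block_mx 1%:M u 0 1%:M) => //.
  rewrite (invmx_eq uQ) mulmx_block r0 mulmx_block block_mxKur.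
  by rewrite !(mul1mx, mulmx1, mulmx0, add0r) mulmxN.
have vE x : v (x *: delta_mx 0 j) 0 j
            = x * (N j j - a 0 0) - x * x * c j 0.
  rewrite /v -!scalemxAl -!rowE [LHS]mxE [X in X + _]mxE [X in - X + _]mxE.
  rewrite big_ord1 !mxE !eqxx mulr1 mulrC.
  by rewrite mulrDr opprD mulrBr mulrA addrC addrA.
have [vd|nvd] := eqVneq (v (1 *: delta_mx 0 j)) 0; last by eexists; exact: nvd.
have [vNd|nvd] := eqVneq (v (- 1 *: delta_mx 0 j)) 0; last first.
  by eexists; exact: nvd.
have /rowP/(_ j) := vd; have /rowP/(_ j) := vNd.
rewrite !vE !mxE mulrNN !mul1r mulN1r => /eqP.
rewrite subr_eq0 => /eqP <- /eqP.
rewrite opprK -mulr2n -mulr_natl mulf_eq0 (pcharf0P K).1 //= subr_eq0 => eqNa.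
by move: neqNa; rewrite /N /a !mxE eqNa.
Qed.

Lemma mxtrace_conj n (P M : 'M[K]_n) : P \in unitmx ->
  \tr (P *m M *m invmx P) = \tr M.
Proof. by move=> uP; rewrite mxtrace_mulC mulmxA mulVmx // mul1mx. Qed.

Lemma conj_mulmx n (P Q M : 'M[K]_n) : P \in unitmx -> Q \in unitmx ->
  Q *m P *m M *m invmx (Q *m P) = Q *m (P *m M *m invmx P) *m invmx Q.
Proof.
move=> uP uQ; rewrite (@invmx_eq _ _ (invmx P *m invmx Q)) ?mulmxA //.
by rewrite mulmxK // mulmxV.
Qed.

Lemma conj_ulsubmx_eq0 n (M : 'M[K]_(1 + n)) : ursubmx M != 0 ->
  exists2 P, P \in unitmx & ulsubmx (P *m M *m invmx P) = 0.
Proof.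
rewrite -{2}[M]submxK.
set a := ulsubmx M; set r := ursubmx M; set c := dlsubmx M; set N := drsubmx M.
case/rV0Pn => j nzrj.
(* The lower shear by [u] turns the corner [a] into [a - r *m u]; this [u] solves [r *m u = a]. *)
pose u : 'cV[K]_n := (a 0 0 / r 0 j) *: delta_mx j 0.
have uQ := mulmx_block_lowerK u; have [uP _] := mulmx1_unit uQ.
exists (block_mx 1%:M 0 u 1%:M) => //.
rewrite (invmx_eq uQ) mulmx_block mulmx_block block_mxKul.
rewrite !(mul1mx, mul0mx, mulmx1, addr0) mulmxN -scalemxAr -colE.
move: nzrj; rewrite !mxE => nzrj.
by apply/matrixP => x y; rewrite !ord1 !mxE divfK ?subrr.
Qed.

(** Induction on the size. A constant diagonal is zero, since its trace is the size times the common
    entry. Otherwise two successive shears clear the corner, the lower right block still has trace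
    zero, and conjugating that block alone preserves the zero corner. *)
Lemma trace0_conj_diag0 n (M : 'M[K]_n) : \tr M = 0 ->
  exists2 P, P \in unitmx & forall i, (P *m M *m invmx P) i i = 0.
Proof.
elim: n M => [|n IHn] M trM; first by exists 1%:M; [exact: unitmx1 | case].
have [/forallP eqM | /forallPn[i neqM]] := boolP [forall i, M i i == M 0 0].
  exists 1%:M => [|i]; first exact: unitmx1.
  rewrite invmx1 mul1mx mulmx1 (eqP (eqM i)).
  move: trM; rewrite /mxtrace (eq_bigr _ (fun i _ => eqP (eqM i))) sumr_const.
  rewrite card_ord -mulr_natl => /eqP.
  by rewrite mulf_eq0 (pcharf0P K).1 //= => /eqP.
have [P uP [P0 trP]] : exists2 P, P \in unitmx &
    ulsubmx (P *m M *m invmx P : 'M_(1 + n)) = 0 /\ \tr (P *m M *m invmx P) = 0.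
  case: (unliftP 0 i) neqM => [j ->|->]; last by rewrite eqxx.
  rewrite -[lift 0 j]rshift1 -[X in _ != M X X](lshift0 n 0).
  case/conj_ursubmx_neq0 => P uP /conj_ulsubmx_eq0[Q uQ Q0].
  exists (Q *m P); first by rewrite unitmx_mul uQ.
  by rewrite mxtrace_conj ?unitmx_mul ?uQ // conj_mulmx.
set M1 : 'M_(1 + n) := P *m M *m invmx P in P0 trP.
have [|Q uQ Q0] := IHn (drsubmx M1).
  by move: trP; rewrite -{1}[M1]submxK (@mxtrace_block _ 1 n) P0 mxtrace0 add0r.
have uQ1 : (block_mx 1%:M 0 0 Q : 'M_(1 + n)) \in unitmx.
  by rewrite unitmxE det_ublock det1 mul1r -unitmxE.
exists ((block_mx 1%:M 0 0 Q : 'M_(1 + n)) *m P).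
  by rewrite unitmx_mul uQ1.
rewrite conj_mulmx // -/M1 -[M1]submxK.
rewrite (@invmx_eq _ _ (block_mx 1%:M 0 0 (invmx Q) : 'M_(1 + n))); last first.
  rewrite mulmx_block !(mul0mx, mulmx0, mul1mx, addr0, add0r) mulmxV //.
  by rewrite -scalar_mx_block.
rewrite !(@mulmx_block _ 1 n 1 n 1 n) P0.
move=> k; rewrite !(mul0mx, mulmx0, mul1mx, mulmx1, addr0, add0r).
case: (unliftP 0 k) => [j ->|->].
  by rewrite -rshift1 (@block_mxEdr _ 1 n 1 n).
by rewrite -(lshift0 n 0) (@block_mxEul _ 1 n 1 n) mxE.
Qed.

Lemma trace0_commutator n (M : 'M[K]_n.+1) (s : 'I_n.+1 -> K) :
    \tr M = 0 -> injective s ->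
  exists D Y (E : 'I_n.+1 -> 'M[K]_n.+1),
    [/\ M = ring_commutator D Y, \sum_k E k = 1,
        forall k, D * E k = s k *: E k & forall k, E k * D = s k *: E k].
Proof.
move=> /trace0_conj_diag0[P uP M0] injs.
have PV : P * invmx P = 1 := mulmxV uP.
have VP : invmx P * P = 1 := mulVmx uP.
pose conj (N : 'M[K]_n.+1) : 'M[K]_n.+1 := invmx P * N * P.
have conjMM N1 N2 : conj N1 * conj N2 = conj (N1 * N2).
  by rewrite /conj !mulrA -(mulrA _ P (invmx P)) PV mulr1.
have [M1 -> M10] : exists2 M1, M = conj M1 & forall i, M1 i i = 0.
  exists (P *m M *m invmx P); last exact: M0.
  rewrite -[_ *m _ *m _]/(P * M * invmx P).
  by rewrite /conj !mulrA VP mul1r -mulrA VP mulr1.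
pose D := diag_mx (\row_k s k).
(* [ad D] multiplies the entry [(i, j)] by [s i - s j]. On the diagonal the division is by zero,
   which is harmless because [M1 i i = 0]. *)
pose Y : 'M[K]_n.+1 := \matrix_(i, j) (M1 i j / (s i - s j)).
have DE N : D * N = \matrix_(i, j) (s i * N i j).
  by rewrite -[_ * _]/(_ *m _) mul_diag_mx; apply/matrixP => i j; rewrite !mxE.
have ED N : N * D = \matrix_(i, j) (N i j * s j).
  by rewrite -[_ * _]/(_ *m _) mul_mx_diag; apply/matrixP => i j; rewrite !mxE.
exists (conj D), (conj Y), (fun k => conj (delta_mx k k)); split.
- rewrite /ring_commutator !conjMM /conj -mulrBl -mulrBr; congr (_ * _ * _).
  rewrite DE ED; apply/matrixP => i j; rewrite !mxE.
  rewrite [_ * s j]mulrC -mulrBl.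
  have [->|nij] := eqVneq i j; first by rewrite M10 mul0r mulr0.
  by rewrite mulrC divfK // subr_eq0 (inj_eq injs).
- rewrite /conj -mulr_suml -mulr_sumr -[RHS]VP.
  congr (_ * _); rewrite -[RHS]mulr1; congr (_ * _).
  by rewrite -mx1_sum_delta.
- move=> k; rewrite conjMM DE /conj scalerAl scalerAr; congr (_ * _ * _).
  by apply/matrixP => i j; rewrite !mxE; case: eqP => [->|]; rewrite ?mulr0.
- move=> k; rewrite conjMM ED /conj scalerAl scalerAr; congr (_ * _ * _).
  apply/matrixP => i j; rewrite !mxE mulrC.
  by case: (j =P k) => [->|]; rewrite ?andbF ?mulr0.
Qed.

End TraceZero.

(** * Commutators modulo the radical, and assembly of the blocks *)

Lemma mxtrace_ring_commutator (R : comPzRingType) n (M N : 'M[R]_n) :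
  \tr (ring_commutator M N) = 0.
Proof. by rewrite /ring_commutator raddfB /= mxtrace_mulC subrr. Qed.

Lemma ring_commutatorD_ideal (K : fieldType) (A : falgType K) (J : {vspace A})
    (b1 b2 n1 n2 : A) :
    (forall a, {in J, forall x, a * x \in J}) ->
    (forall a, {in J, forall x, x * a \in J}) -> n1 \in J -> n2 \in J ->
  exists2 n, n \in J &
    ring_commutator (b1 + n1) (b2 + n2) = ring_commutator b1 b2 + n.
Proof.
move=> JMl JMr n1J n2J.
exists (b1 * n2 + n1 * (b2 + n2) - (b2 * n1 + n2 * (b1 + n1))).
  by apply: memvB; apply: memvD; by [apply: JMl | apply: JMr].
rewrite /ring_commutator [in LHS]mulrDl [(b2 + n2) * _]mulrDl.
rewrite (mulrDr b1) (mulrDr b2) -!(addrA (_ * _)) (opprD (b2 * b1)).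
by rewrite !(addrCA (- (b2 * b1))).
Qed.

Theorem corollary10 (K : closedFieldType) (charK0 : [pchar K] =i pred0)
    (A : falgType K) (btA : generalized_block_triangular A)
    (x1 y1 x2 y2 : A) :
  exists x y : A,
    ring_commutator x1 y1 + ring_commutator x2 y2 = ring_commutator x y.
Proof.
case: btA => J [B [r [d [phi [e [radJ [B1 BJ _] [g phiK gK] phie eJe]]]]]].
have JMl a : {in J, forall x, a * x \in J}.
  by move=> x; apply: jacobson_radicalMl.
have JMr a : {in J, forall x, x * a \in J}.
  by move=> x; apply: jacobson_radicalMr.
have phi_inj u v : (forall i, phi i u = phi i v) -> u = v.
  move=> eq_uv; apply: (can_inj phiK); apply/ffunP => i.
  by rewrite !ffunE; exact: eq_uv.
have phi_surj (F : forall i, 'M[K]_((d i).+1)) :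
    exists b, forall i, phi i b = F i.
  exists (g [ffun i => F i]) => i.
  by have /ffunP/(_ i) := gK [ffun i => F i]; rewrite !ffunE.
have valM (u v : subvs_of B) : vsval (u * v) = vsval u * vsval v by [].
have val1 : vsval (1 : subvs_of B) = 1 by apply/eqP; rewrite algid_eq1.
have splitBJ x : exists b : subvs_of B, exists2 n, n \in J & x = vsval b + n.
  have: x \in (B + J)%VS by rewrite BJ memvf.
  by case/memv_addP => b bB [n nJ ->]; exists (Subvs bB), n.
have comm_split x y : exists2 b : subvs_of B, forall i, \tr (phi i b) = 0
    & exists2 n, n \in J & ring_commutator x y = vsval b + n.
  have [b [n nJ ->]] := splitBJ x; have [c [m mJ ->]] := splitBJ y.
  have [p pJ ->] := ring_commutatorD_ideal (vsval b) (vsval c) JMl JMr nJ mJ.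
  exists (ring_commutator b c); last by exists p; rewrite // raddfB.
  by move=> i; rewrite rmorphB !rmorphM mxtrace_ring_commutator.
have [b1 trb1 [n1 n1J ->]] := comm_split x1 y1.
have [b2 trb2 [n2 n2J ->]] := comm_split x2 y2.
pose T : finType := {i : 'I_r & 'I_(d i).+1}.
(* Ranking the diagonal positions of all blocks together makes the eigenvalues distinct across
   blocks as well as within each. *)
pose s (t : T) : K := (enum_rank t)%:R.
have injs : injective s.
  by move=> t u /(natr_inj_pchar0 charK0)/ord_inj/enum_rank_inj.
have block i : exists DYE : 'M[K]_((d i).+1) * 'M[K]_((d i).+1)
                            * ('I_(d i).+1 -> 'M[K]_((d i).+1)),
    [/\ phi i (b1 + b2) = ring_commutator DYE.1.1 DYE.1.2,
        \sum_k DYE.2 k = 1,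
        forall k, DYE.1.1 * DYE.2 k = s (Tagged _ k) *: DYE.2 k
      & forall k, DYE.2 k * DYE.1.1 = s (Tagged _ k) *: DYE.2 k].
  have [||D [Y [E spec]]] := @trace0_commutator K charK0 _
    (phi i (b1 + b2)) (fun k => s (Tagged _ k)).
  - by rewrite !raddfD /= trb1 trb2 addr0.
  - by move=> k l /injs/eqP; rewrite eq_Tagged => /eqP.
  by exists (D, Y, E).
have [DYE specDYE] := fin_all_exists block.
have [D phiD] := phi_surj (fun i => (DYE i).1.1).
have [Y phiY] := phi_surj (fun i => (DYE i).1.2).
(* [E t] lives in the block [tag t] only. The cast [inord] makes the formula typecheck in every
   block [i]; it is the identity when [i] is [tag t], and the factor in front is zero otherwise. *)
have [E phiE] := @fin_all_exists T (fun=> subvs_of B)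
  (fun t b => forall i,
     phi i b = (i == tag t)%:R * (DYE i).2 (inord (tagged t)))
  (fun=> phi_surj _).
have b12 : b1 + b2 = ring_commutator D Y.
  apply: phi_inj => i; rewrite rmorphB !rmorphM /= phiD phiY.
  by have [-> _ _ _] := specDYE i.
have sumE : \sum_t vsval (E t) = 1.
  rewrite -val1 -raddf_sum; congr vsval; apply: phi_inj => i.
  rewrite raddf_sum rmorph1 /=; have [_ <- _ _] := specDYE i.
  transitivity (\sum_j \sum_(k < (d j).+1) (i == j)%:R * (DYE i).2 (inord k)).
    by rewrite sig_big_dep; apply: eq_bigr => t _; rewrite phiE.
  rewrite (bigD1 i) //= [X in _ + X]big1 ?addr0 => [|j].
    by apply: eq_bigr => k _; rewrite eqxx mul1r inord_val.
  by rewrite eq_sym => /negPf->; rewrite big1 // => k _; rewrite mul0r.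
have DE t : vsval D * vsval (E t) = s t *: vsval (E t).
  rewrite -valM -linearZ; congr vsval; apply: phi_inj => i.
  rewrite rmorphM linearZ /= phiD phiE; have [_ _ DE _] := specDYE i.
  case: t => j k /=; case: eqP => [ij|]; last by rewrite !mul0r mulr0 scaler0.
  by case: j / ij k => k; rewrite !mul1r inord_val DE.
have ED t : vsval (E t) * vsval D = s t *: vsval (E t).
  rewrite -valM -linearZ; congr vsval; apply: phi_inj => i.
  rewrite rmorphM linearZ /= phiD phiE; have [_ _ _ ED] := specDYE i.
  case: t => j k /=; case: eqP => [ij|]; last by rewrite !mul0r scaler0.
  by case: j / ij k => k; rewrite !mul1r inord_val ED.
have eE t : e (tag t) * E t = E t.
  apply: phi_inj => i; rewrite rmorphM /= phie phiE.
  by case: eqP; rewrite ?mul1r ?mul0r.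
have Ee t : E t * e (tag t) = E t.
  apply: phi_inj => i; rewrite rmorphM /= phie phiE.
  by case: eqP; rewrite ?mul1r ?mulr1 ?mul0r.
(* [E t] absorbs the block idempotent [e (tag t)] on either side, so this reduces to
   [e_i J e_i = 0], the diagonal case of block triangularity. *)
have EJE t : {in J, forall m, vsval (E t) * m * vsval (E t) = 0}.
  move=> m mJ; rewrite -{1}(Ee t) -{2}(eE t) !valM -!mulrA (mulrA m).
  by rewrite (mulrA (vsval (e _))) (mulrA (vsval (e _)) m) eJe // mul0r mulr0.
have [|m nE] := @ad_surjective K A J (vsval D) T (vsval \o E) s
  sumE injs DE ED EJE (JMl _) (JMr _) (n1 + n2); first exact: memvD.
exists (vsval D), (vsval Y + m).
have b12val : vsval b1 + vsval b2 = ring_commutator (vsval D) (vsval Y).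
  by rewrite -[LHS](raddfD vsval) b12 [LHS](raddfB vsval).
rewrite addrACA b12val nE /ring_commutator.
by rewrite mulrDr mulrDl opprD addrACA.
Qed.
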